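(* Let $f$ be a bounded, Lebesgue integrable function on $[0,1]$, let $a_1(n)$ be a bounded real sequence and let $a_0(n)$, $a_1(n)$ satisfy $2a_0(n)+a_1(n)=1$ for all $n$. Then $$\|D_n^{M,1}f-f\|\le \left(3|a_1(n)|+1\right)\left(1+\sqrt{2}\right)\omega\left(f;\frac{1}{\sqrt{n}}\right),\quad n\ge 1.$$
   Context: For integers $n\ge 0$ and $k$, $p_{n,k}(x)=\binom{n}{k}x^k(1-x)^{n-k}$ for $0\le k\le n$, and $p_{n,k}(x)=0$ if $k<0$ or $k>n$. Given real sequences $a_0(n),a_1(n)$, put $a(x,n)=a_1(n)x+a_0(n)$ and, for $n\ge 1$, $$p_{n,k}^{M,1}(x)=a(x,n)\,p_{n-1,k}(x)+a(1-x,n)\,p_{n-1,k-1}(x),\quad 0\le k\le n$$ (so $p_{n,0}^{M,1}(x)=a(x,n)(1-x)^{n-1}$ and $p_{n,n}^{M,1}(x)=a(1-x,n)x^{n-1}$). The operator $D_n^{M,1}$ is $$D_n^{M,1}(f;x)=(n+1)\sum_{k=0}^{n}p_{n,k}^{M,1}(x)\int_0^1 p_{n,k}(t)f(t)\,dt,\quad x\in[0,1],$$ and $D_n^{M,1}f$ denotes the function $x\mapsto D_n^{M,1}(f;x)$. Here $\|\cdot\|$ is the uniform (supremum) norm on $[0,1]$ and $\omega(f;\delta)=\sup\{|f(u)-f(v)|:u,v\in[0,1],\ |u-v|\le\delta\}$ is the first order modulus of continuity. *)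

(* Defs.v *)
From HB Require Import structures.
From mathcomp Require Import all_boot all_order all_algebra.
From mathcomp Require Import all_classical all_reals all_analysis.

Set Implicit Arguments.
Unset Strict Implicit.
Unset Printing Implicit Defensive.

Import Order.TTheory GRing.Theory Num.Theory.
Import numFieldNormedType.Exports.

Local Open Scope classical_set_scope.
Local Open Scope ring_scope.

(* The index k is an integer: the operator below uses the index k - 1 with
   k = 0. For m > n the polynomial vanishes because 'C(n, m) = 0. *)
Definition bernstein {R : realType} (n : nat) (k : int) (x : R) : R :=
  if k is Posz m then 'C(n, m)%:R * x ^+ m * (1 - x) ^+ (n - m) else 0.

Definition acoef {R : realType} (a0 a1 : nat -> R) (x : R) (n : nat) : R :=
  a1 n * x + a0 n.

(* Intended for n >= 1 only. *)
Definition bernsteinM1 {R : realType} (a0 a1 : nat -> R)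
    (n : nat) (k : int) (x : R) : R :=
  acoef a0 a1 x n * bernstein n.-1 k x +
  acoef a0 a1 (1 - x) n * bernstein n.-1 (k - 1) x.

(* Integrals are taken for the completed Lebesgue measure, so that integrands
   are Lebesgue measurable; [lebesgue_measure] is restricted to Borel sets. *)
Definition durrmeyerM1 {R : realType} (a0 a1 : nat -> R)
    (n : nat) (f : R -> R) (x : R) : R :=
  n.+1%:R * \sum_(0 <= k < n.+1) bernsteinM1 a0 a1 n k%:Z x *
    \int[@completed_lebesgue_measure R]_(t in `[0, 1]) (bernstein n k%:Z t * f t).

(* Suprema are taken in the extended reals, as [sup] of an unbounded set of
   reals is 0. *)
Definition unorm01 {R : realType} (g : R -> R) : \bar R :=
  ereal_sup [set `|g x|%:E | x in `[0, 1]].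

Definition omega01 {R : realType} (f : R -> R) (delta : R) : \bar R :=
  ereal_sup [set e : \bar R | exists u v : R,
    [/\ u \in `[0, 1], v \in `[0, 1], `|u - v| <= delta &
        e = `|f u - f v|%:E]].

(* Main.v *)
Require Import Defs.
From mathcomp Require Import all_boot all_order all_algebra.
From mathcomp Require Import all_classical all_reals all_analysis.
From mathcomp Require Import measurable_realfun.
From mathcomp Require Import zify ring lra.

Import Order.TTheory GRing.Theory Num.Theory.
Import numFieldNormedType.Exports.

Local Open Scope classical_set_scope.
Local Open Scope ring_scope.

(** The operator maps g to (n+1) * sum_k w_k * (integral of p_(n,k) * g), with
weights w_k = a(x,n) p_(n-1,k)(x) + a(1-x,n) p_(n-1,k-1)(x).
The two families of values p_(n-1,k)(x) and p_(n-1,k-1)(x) are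
probability distributions in k, and each (n+1) p_(n,k) is the density of the
Beta(k+1, n-k+1) distribution. As a(x,n) + a(1-x,n) = 2 a_0(n) + a_1(n) = 1,
the operator reproduces constants, hence the error at x is the operator applied
to t |-> f(t) - f(x).

Joining t to x by steps of length at most d gives
|f(t) - f(x)| <= (1 + ((t - x)/d)^2) omega(f; d) ([modulus_quadratic]). With d = 1/sqrt n it remains to bound
|a(x,n)| E_1 + |a(1-x,n)| E_2, where E_1 and E_2 are the averages of
1 + n (t - x)^2 for the two mixtures of Beta densities. Both averages are
explicit: the Beta moments turn the quadratic in t into a quadratic in k
([Rintegral_bernstein_quadratic]), whose binomial average is known
([sum_bernstein_quadratic]). With m = n-1 the contribution of n (t - x)^2 to E_1 is
n ((2m - 8) x (1-x) + 4 x^2 + 2) / ((m + 3) (m + 4)), which is at most 1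
([second_moment_bound]), and E_2 is E_1 with x replaced by 1-x. So E_1 and E_2
are at most 2.

Finally a(x,n) = a_1(n) (x - 1/2) + 1/2 is at most (|a_1(n)| + 1)/2 in absolute
value, so the error is at most 2 (|a_1(n)| + 1) omega(f; 1/sqrt n), and this is
below the stated bound because |a_1(n)| <= 3 |a_1(n)| and 2 <= 1 + sqrt 2. *)

(* The Lebesgue measurable sets of the reals, as the measurable space that
   carries the completed measure. *)
Local Notation lebesgueType R :=
  (caratheodory_type ((@wlength R idfun)^*)%mu) (only parsing).
Local Notation cmu R := (@completed_lebesgue_measure R) (only parsing).

(** * Integration of polynomials for the completed Lebesgue measure *)

Lemma measurable_fun_completed (R : realType) d (V : measurableType d)
  (g : measurableTypeR R -> V) :
  measurable_fun setT g ->
  @measurable_fun _ _ (lebesgueType R) _ setT g.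
Proof.
move=> mg _ Y mY; apply: sub_caratheodory; exact: mg.
Qed.

Lemma measurable_itv01 (R : realType) :
  @measurable _ (lebesgueType R) `[0, 1].
Proof. apply: sub_caratheodory. exact: measurable_itv. Qed.

Lemma completed_lebesgue_measure_itv01 (R : realType) :
  cmu R `[0, 1]%classic = 1%:E.
Proof.
transitivity (@lebesgue_measure R `[0, 1]%classic) => //.
by rewrite lebesgue_measure_itv/= lte_fin ltr01 oppr0 adde0.
Qed.

Lemma integrable_completed_XMonemX (R : realType) (k l : nat) :
  (cmu R).-integrable `[0, 1] (EFin \o XMonemX k l).
Proof.
apply: measurable_bounded_integrable.
- exact: measurable_itv01.
- by rewrite [ltLHS](completed_lebesgue_measure_itv01 R) ltry.
- apply: measurable_funTS; apply: measurable_fun_completed => //.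
  exact: (@measurable_XMonemX R setT k l).
- exact: bounded_XMonemX.
Qed.

(** The Beta integral is known for the Borel measure, which is the image of the
completed one under the identity map, so a change of variables transfers it. *)
Lemma Rintegral_completed_XMonemX (R : realType) (k l : nat) :
  \int[cmu R]_(t in `[0, 1]) XMonemX k l t =
  (k`! * l`!)%:R / (k + l).+1`!%:R.
Proof.
rewrite -beta_fun_fact /beta_fun -Rintegral_mkcond.
rewrite /Rintegral; congr fine.
have mid : @measurable_fun _ _ (lebesgueType R)
    (measurableTypeR R) setT idfun.
  refine (@measurable_fun_completed R _ (measurableTypeR R) idfun _).
  exact: measurable_id.
pose g : measurableTypeR R -> \bar R := EFin \o XMonemX k l.
have mg : measurable_fun setT g.
  by apply/measurable_EFinP; exact: (@measurable_XMonemX R setT k l).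
have m01 : @measurable _ (measurableTypeR R) `[0, 1] by exact: measurable_itv.
rewrite -[LHS](@integral_pushforward _ _ _ _ R _ mid
  (cmu R) `[0, 1] g mg
  (integrable_completed_XMonemX R k l) m01).
exact: eq_measure_integral.
Qed.

Lemma integrable_XMonemX_mul (R : realType) (k l : nat) (f : R -> R) :
  (cmu R).-integrable `[0, 1] (EFin \o f) ->
  (cmu R).-integrable `[0, 1]
    (EFin \o (fun t => XMonemX k l t * f t)).
Proof.
move=> fi.
have mX : measurable_fun
    (`[0%R, 1%R]%classic : set (lebesgueType R))
    (XMonemX k l : _ -> R).
  apply: measurable_funTS; apply: measurable_fun_completed.
  exact: (@measurable_XMonemX R setT k l).
exact: (integrableMr (measurable_itv01 R) mX (bounded_XMonemX k l) fi).
Qed.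

Lemma bernsteinE (R : realType) (n k : nat) (t : R) :
  bernstein n k%:Z t = 'C(n, k)%:R * XMonemX k (n - k) t.
Proof. by rewrite /= mulrA. Qed.

Lemma integrable_bernstein_mul (R : realType) (n k : nat) (f : R -> R) :
  (cmu R).-integrable `[0, 1] (EFin \o f) ->
  (cmu R).-integrable `[0, 1]
    (EFin \o (fun t => bernstein n k%:Z t * f t)).
Proof.
move=> /(integrable_XMonemX_mul R k (n - k)) fi.
have := integrableZl (measurable_itv01 R) 'C(n, k)%:R fi.
by apply: eq_integrable => [|t _]; [exact: measurable_itv01|
  rewrite /= -EFinM !mulrA].
Qed.

Lemma integrable_quadratic (R : realType) (A B C : R) :
  (cmu R).-integrable `[0, 1]
    (EFin \o (fun t => A + B * t + C * t ^+ 2)).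
Proof.
have m01 := measurable_itv01 R.
have i j := integrable_completed_XMonemX R j 0.
have := integrableD m01 (integrableD m01 (integrableZl m01 A (i 0%N))
  (integrableZl m01 B (i 1%N))) (integrableZl m01 C (i 2%N)).
by apply: eq_integrable => // t _; rewrite /= !XMonemXn0 -!EFinM -!EFinD mulr1.
Qed.

Lemma integrable_completed_cst (R : realType) (c : R) :
  (cmu R).-integrable `[0, 1] (EFin \o (fun=> c)).
Proof.
have := integrable_quadratic R c 0 0.
apply: eq_integrable => [|t _]; first exact: measurable_itv01.
by rewrite /= !mul0r !addr0.
Qed.

(** The mean of A + B t + C t^2 for the Beta(k+1, n-k+1) distribution, whose
density is (n+1) p_(n,k). *)
Definition beta_quadratic_mean {R : realType} (n : nat) (A B C : R) (k : nat) : R :=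
  A + B * (k%:R + 1) / (n%:R + 2) +
  C * ((k%:R + 1) * (k%:R + 2)) / ((n%:R + 2) * (n%:R + 3)).

(** Multiplying p_(n,k) by t^j only shifts the first exponent, so this is a
combination of the Beta integrals with exponents (k+j, n-k) for j = 0, 1, 2. *)
Lemma Rintegral_bernstein_quadratic (R : realType) (n k : nat) (A B C : R) :
  (k <= n)%N ->
  n.+1%:R * \int[cmu R]_(t in `[0, 1])
    (bernstein n k%:Z t * (A + B * t + C * t ^+ 2)) = beta_quadratic_mean n A B C k.
Proof.
move=> kn.
have m01 := measurable_itv01 R.
have i j := integrable_completed_XMonemX R j (n - k).
have iZ c j : (cmu R).-integrable `[0, 1]
    (EFin \o (fun t => c * XMonemX j (n - k) t)).
  have := integrableZl m01 c (i j).
  by apply: eq_integrable => // t _; rewrite /= -EFinM.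
have iD : (cmu R).-integrable `[0, 1]
    (EFin \o (fun t => 'C(n, k)%:R * A * XMonemX k (n - k) t +
                       'C(n, k)%:R * B * XMonemX k.+1 (n - k) t)).
  have := integrableD m01 (iZ ('C(n, k)%:R * A) k) (iZ ('C(n, k)%:R * B) k.+1).
  by apply: eq_integrable => // t _; rewrite /= -EFinD.
rewrite (_ : \int[_]_(t in _) _ =
    'C(n, k)%:R * A * ((k`! * (n - k)`!)%:R / n.+1`!%:R) +
    'C(n, k)%:R * B * ((k.+1`! * (n - k)`!)%:R / n.+2`!%:R) +
    'C(n, k)%:R * C * ((k.+2`! * (n - k)`!)%:R / n.+3`!%:R)); last first.
  have betaE j : (k <= j)%N -> (j`! * (n - k)`!)%:R / (n + (j - k)).+1`!%:R =
      \int[cmu R]_(t in `[0, 1]) XMonemX j (n - k) t.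
    move=> kj; rewrite Rintegral_completed_XMonemX.
    by rewrite (_ : j + (n - k) = n + (j - k))%N//; lia.
  have := betaE k (leqnn k); rewrite subnn addn0 => ->.
  have := betaE k.+1 (leqW (leqnn k)); rewrite subSnn addn1 => ->.
  have := betaE k.+2 (leqW (leqW (leqnn k))).
  rewrite (_ : n + (k.+2 - k) = n.+2)%N; last lia.
  move=> ->.
  rewrite -!RintegralZl// -RintegralD// -RintegralD//.
  apply: eq_Rintegral => t _; rewrite bernsteinE /XMonemX !exprS; ring.
have nE : 'C(n, k)%:R * (k`!%:R * (n - k)`!%:R) = n`!%:R :> R.
  by rewrite -!natrM bin_fact.
rewrite /beta_quadratic_mean !(factS, natrM) -nE.
rewrite -[n.+3%:R]natr1 -[n.+2%:R]natr1 -[n.+1%:R]natr1.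
rewrite -[k.+2%:R]natr1 -[k.+1%:R]natr1.
have c0 : 'C(n, k)%:R != 0 :> R by rewrite pnatr_eq0 -lt0n bin_gt0.
have f0 j : j`!%:R != 0 :> R by rewrite pnatr_eq0 -lt0n fact_gt0.
have n0 : (0 : R) <= n%:R by [].
have n1 : n%:R + 1 != 0 :> R by lra.
have n2 : n%:R + 2 != 0 :> R by lra.
have n3 : n%:R + 3 != 0 :> R by lra.
field.
by rewrite n1 n2 n3 c0 !f0.
Qed.

(** * Averages over the Bernstein weights *)

Lemma bernsteinS_pred (R : realType) (m k : nat) (x : R) :
  bernstein m (k.+1%:Z - 1) x = bernstein m k%:Z x.
Proof. by rewrite -addn1 PoszD addrK. Qed.

Lemma bernstein_ge0 (R : realType) (m : nat) (k : int) (x : R) :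
  0 <= x <= 1 -> 0 <= bernstein m k x.
Proof.
move=> /andP[x0 x1]; case: k => //= k.
by rewrite !mulr_ge0// exprn_ge0// subr_ge0.
Qed.

(** With g arbitrary, this applies to the weights of the operator, to their
bounds by absolute values, and to the Pascal recurrence alike. *)
Lemma sum_bernstein_shift (R : realType) (m : nat) (al be x : R) (g : nat -> R) :
  \sum_(0 <= k < m.+2)
     (al * bernstein m k%:Z x + be * bernstein m (k%:Z - 1) x) * g k =
  al * \sum_(0 <= k < m.+1) bernstein m k%:Z x * g k +
  be * \sum_(0 <= k < m.+1) bernstein m k%:Z x * g k.+1.
Proof.
under eq_bigr do rewrite mulrDl -(mulrA al) -(mulrA be).
rewrite big_split/= -!mulr_sumr; congr (_ * _ + _ * _).
  by rewrite big_nat_recr//= bin_small// !mul0r addr0.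
rewrite [LHS]big_nat_recl//.
have -> : bernstein m (0%:Z - 1) x = 0 :> R by [].
rewrite mul0r add0r.
by apply: eq_bigr => k _; rewrite bernsteinS_pred.
Qed.

(** Pascal's recurrence: the weights of degree m+1 have the shape of those of the
operator, with coefficients 1-x and x. *)
Lemma bernsteinS (R : realType) (m k : nat) (x : R) :
  bernstein m.+1 k%:Z x =
  (1 - x) * bernstein m k%:Z x + x * bernstein m (k%:Z - 1) x.
Proof.
case: k => [|k].
  by rewrite /= !bin0 !expr0 !subn0 !mul1r mulr0 addr0 exprS.
rewrite bernsteinS_pred /= binS natrD subSS.
have [km|mk] := ltnP k m; last first.
  by rewrite (@bin_small _ k.+1)// exprS; ring.
rewrite (_ : (m - k = (m - k.+1).+1)%N); last by rewrite subnSK.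
by rewrite !exprS; ring.
Qed.

(** The mean and the variance of a binomial variable. The general quadratic makes
the induction go through, since Pascal's recurrence replaces k by k+1. *)
Lemma sum_bernstein_quadratic (R : realType) (m : nat) (x A B C : R) :
  \sum_(0 <= k < m.+1) bernstein m k%:Z x * (A + B * k%:R + C * k%:R ^+ 2) =
  A + B * (m%:R * x) + C * (m%:R * (x * (1 - x)) + (m%:R * x) ^+ 2).
Proof.
elim: m A B C => [|m IH] A B C.
  by rewrite big_nat1 /= bin0 !expr0; ring.
under eq_bigr do rewrite bernsteinS.
rewrite sum_bernstein_shift IH.
under [X in _ + x * X]eq_bigr => k _.
  rewrite (_ : A + B * k.+1%:R + C * k.+1%:R ^+ 2 =
    (A + B + C) + (B + 2 * C) * k%:R + C * k%:R ^+ 2); last first.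
    by rewrite -natr1; ring.
  over.
by rewrite IH -natr1; ring.
Qed.

(** From x (1-x) <= 1/4 and x^2 <= 1 the bracket is at most M/2 + 6. *)
Lemma second_moment_bound (R : realFieldType) (M x : R) :
  0 <= M -> 0 <= x <= 1 ->
  (M + 1) * ((2 * M - 8) * (x * (1 - x)) + 4 * x ^+ 2 + 2) <=
  (M + 3) * (M + 4).
Proof.
move=> M0 /andP[x0 x1].
have q1 : x * (1 - x) <= 1 / 4 by have := sqr_ge0 (x - 1 / 2); lra.
have q0 : 0 <= x * (1 - x) by rewrite mulr_ge0// subr_ge0.
have x2 : x ^+ 2 <= 1 by rewrite expr_le1.
have h : (2 * M - 8) * (x * (1 - x)) + 4 * x ^+ 2 + 2 <= M / 2 + 6.
  have := ler_wpM2l M0 q1; lra.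
apply: (le_trans (ler_wpM2l _ h)); first lra.
nra.
Qed.

(** The coefficients are those of 1 + n (t - x)^2 with n = m+1: the constant 1
contributes 1, and the second moment about x, times n, at most 1. *)
Lemma bernstein_beta_mean_le2 (R : realType) (m : nat) (x : R) : 0 <= x <= 1 ->
  \sum_(0 <= k < m.+1) bernstein m k%:Z x *
    beta_quadratic_mean m.+1 (1 + m.+1%:R * x ^+ 2) (m.+1%:R * (- 2 * x)) m.+1%:R k <= 2.
Proof.
move=> x01.
have M0 : (0 : R) <= m%:R by [].
rewrite /beta_quadratic_mean.
have : m.+1%:R = m%:R + 1 :> R by rewrite natr1.
move: (m.+1%:R : R) => N NE.
have n2 : N + 2 != 0 by rewrite NE; lra.
have n3 : N + 3 != 0 by rewrite NE; lra.
pose D := (N + 2) * (N + 3).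
under eq_bigr => k _.
  rewrite (_ : _ + _ + _ =
    (1 + N * x ^+ 2 + N * (- 2 * x) / (N + 2) + 2 * N / D) +
    (N * (- 2 * x) / (N + 2) + 3 * N / D) * k%:R + (N / D) * k%:R ^+ 2);
    last first.
    by rewrite /D; field; rewrite n2 n3.
  over.
rewrite sum_bernstein_quadratic.
have -> : 2 = 1 + 1 :> R by [].
have -> : 1 + N * x ^+ 2 + N * (- 2 * x) / (N + 2) + 2 * N / D +
  (N * (- 2 * x) / (N + 2) + 3 * N / D) * (m%:R * x) +
  N / D * (m%:R * (x * (1 - x)) + (m%:R * x) ^+ 2) =
  1 + N * ((2 * m%:R - 8) * (x * (1 - x)) + 4 * x ^+ 2 + 2) / D.
  rewrite /D NE; field.
  by rewrite -NE n2 n3.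
rewrite lerD2l ler_pdivrMr ?mul1r.
  by have := second_moment_bound _ _ _ M0 x01; rewrite /D NE; lra.
by rewrite /D mulr_gt0// NE; lra.
Qed.

(** The reflection t |-> 1-t, k |-> n-k exchanges this average with the previous
one at 1-x, so the same polynomial inequality is used at 1-x. *)
Lemma bernstein_beta_mean_shift_le2 (R : realType) (m : nat) (x : R) : 0 <= x <= 1 ->
  \sum_(0 <= k < m.+1) bernstein m k%:Z x *
    beta_quadratic_mean m.+1 (1 + m.+1%:R * x ^+ 2) (m.+1%:R * (- 2 * x)) m.+1%:R k.+1
    <= 2.
Proof.
move=> x01.
have M0 : (0 : R) <= m%:R by [].
rewrite /beta_quadratic_mean.
have : m.+1%:R = m%:R + 1 :> R by rewrite natr1.
move: (m.+1%:R : R) => N NE.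
have n2 : N + 2 != 0 by rewrite NE; lra.
have n3 : N + 3 != 0 by rewrite NE; lra.
pose D := (N + 2) * (N + 3).
under eq_bigr => k _.
  rewrite (_ : _ + _ + _ =
    (1 + N * x ^+ 2 + 2 * N * (- 2 * x) / (N + 2) + 6 * N / D) +
    (N * (- 2 * x) / (N + 2) + 5 * N / D) * k%:R + (N / D) * k%:R ^+ 2);
    last first.
    by rewrite /D -[k.+1%:R]natr1; field; rewrite n2 n3.
  over.
rewrite sum_bernstein_quadratic.
have -> : 2 = 1 + 1 :> R by [].
have -> : 1 + N * x ^+ 2 + 2 * N * (- (1 + 1) * x) / (N + (1 + 1)) + 6 * N / D +
  (N * (- (1 + 1) * x) / (N + (1 + 1)) + 5 * N / D) * (m%:R * x) +
  N / D * (m%:R * (x * (1 - x)) + (m%:R * x) ^+ 2) =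
  1 + N * ((2 * m%:R - 8) * ((1 - x) * (1 - (1 - x))) + 4 * (1 - x) ^+ 2 + 2) / D.
  rewrite /D NE; field.
  by rewrite -NE n2 n3.
rewrite lerD2l ler_pdivrMr ?mul1r.
  have x01' : 0 <= 1 - x <= 1 by lra.
  by have := second_moment_bound _ _ _ M0 x01'; rewrite /D NE; lra.
by rewrite /D mulr_gt0// NE; lra.
Qed.

(** * The modulus of continuity *)

Lemma omega01_ge0 (R : realType) (f : R -> R) (d : R) :
  0 <= d -> (0 <= omega01 f d)%E.
Proof.
move=> d0; apply: ereal_sup_ubound; exists 0, 0; split => //.
- by rewrite in_itv/= lexx ler01.
- by rewrite in_itv/= lexx ler01.
- by rewrite subrr normr0.
- by rewrite subrr normr0.
Qed.

(** The point that divides the segment from u to v in the ratio 1 : k+1 is within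
d of u and within (k+1) d of v. *)
Lemma modulus_chain (R : realType) (f : R -> R) (d w : R) :
  (omega01 f d <= w%:E)%E -> forall (k : nat) (u v : R),
  u \in `[0, 1] -> v \in `[0, 1] -> `|u - v| <= k.+1%:R * d ->
  `|f u - f v| <= k.+1%:R * w.
Proof.
move=> fw; elim=> [|k IH] u v u01 v01.
  rewrite !mul1r => uv; rewrite -lee_fin; apply: le_trans fw.
  by apply: ereal_sup_ubound; exists u, v.
move=> uv; have k0 : (0 : R) <= k%:R by [].
have k2 : (0 : R) < k.+2%:R by [].
pose c := u + (v - u) / k.+2%:R.
have s0 : (0 : R) <= k.+2%:R^-1 by rewrite invr_ge0.
have s1 : (k.+2%:R^-1 : R) <= 1 by rewrite invf_le1// ler1n.
have c01 : c \in `[0, 1].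
  move: u01 v01; rewrite !in_itv/= => /andP[u0 u1] /andP[v0 v1].
  set s : R := k.+2%:R^-1 in s0 s1 *.
  have -> : c = u * (1 - s) + v * s by rewrite /c -/s; ring.
  have := mulr_ge0 u0 (_ : 0 <= 1 - s); have := mulr_ge0 v0 s0.
  have := ler_wpM2r (_ : 0 <= 1 - s) u1; have := ler_wpM2r s0 v1.
  rewrite !subr_ge0 !mul1r => vs /(_ s1) us vs0 /(_ s1) us0; lra.
have uc : `|u - c| <= d.
  rewrite /c opprD addNKr normrN normrM (ger0_norm s0) distrC.
  by rewrite ler_pdivrMr// mulrC.
have cv : `|c - v| <= k.+1%:R * d.
  have -> : c - v = (u - v) * (k.+1%:R / k.+2%:R).
    rewrite /c -[k.+2%:R]natr1; field.
    by apply: lt0r_neq0; rewrite -?natr1; lra.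
  rewrite normrM (ger0_norm (divr_ge0 _ _))// mulrA ler_pdivrMr//.
  have := ler_wpM2r (ler0n R k.+1) uv; lra.
have -> : f u - f v = (f u - f c) + (f c - f v) by ring.
apply: (le_trans (ler_normD _ _)).
rewrite -[k.+2%:R]natr1 mulrDl mul1r addrC lerD//; first exact: IH.
rewrite -lee_fin; apply: le_trans fw.
by apply: ereal_sup_ubound; exists u, c.
Qed.

(** With y = |u - v|/d, one step suffices if y <= 1. Otherwise floor(y) + 1 steps
do, and floor(y) + 1 <= y + 1 <= y^2 + 1. *)
Lemma modulus_quadratic (R : realType) (f : R -> R) (d w : R) :
  0 < d -> 0 <= w -> (omega01 f d <= w%:E)%E -> forall u v : R,
  u \in `[0, 1] -> v \in `[0, 1] ->
  `|f u - f v| <= (1 + ((u - v) / d) ^+ 2) * w.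
Proof.
move=> d0 w0 fw u v u01 v01.
set y := (u - v) / d.
have ny : `|u - v| = `|y| * d.
  by rewrite /y normrM normfV (gtr0_norm d0) divfK// lt0r_neq0.
have [y1|y1] := leP `|y| 1.
  have : `|u - v| <= 1%:R * d by rewrite ny ler_pM2r.
  move=> /(modulus_chain _ _ _ _ fw _ _ _ u01 v01) /le_trans; apply.
  by rewrite ler_wpM2r// lerDl sqr_ge0.
have /andP[t1 t2] := truncn_itv (normr_ge0 y).
have : `|u - v| <= (Num.truncn `|y|).+1%:R * d by rewrite ny ler_pM2r// ltW.
move=> /(modulus_chain _ _ _ _ fw _ _ _ u01 v01) /le_trans; apply.
rewrite ler_wpM2r// -natr1 addrC lerD2l -real_normK ?num_real//.
nra.
Qed.

(** * The error of the operator *)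

(** Since (n+1) p_(n,k) has integral 1, the left-hand side is an average of
f(t) - f(x), to which [modulus_quadratic] applies with d = 1/sqrt n. *)
Lemma Rintegral_bernstein_error (R : realType) (f : R -> R) (n k : nat) (x w : R) :
  (cmu R).-integrable `[0, 1] (EFin \o f) ->
  (0 < n)%N -> (k <= n)%N -> x \in `[0, 1] -> 0 <= w ->
  (omega01 f (Num.sqrt n%:R)^-1 <= w%:E)%E ->
  `|n.+1%:R * (\int[cmu R]_(t in `[0, 1])
      (bernstein n k%:Z t * f t)) - f x| <=
  beta_quadratic_mean n (1 + n%:R * x ^+ 2) (n%:R * (- 2 * x)) n%:R k * w.
Proof.
move=> fi n0 kn x01 w0 fw.
have m01 := measurable_itv01 R.
have nx0 : (0 : R) < n%:R by rewrite ltr0n.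
have c1 : n.+1%:R * \int[cmu R]_(t in `[0, 1])
    (bernstein n k%:Z t * f x) = f x.
  have := Rintegral_bernstein_quadratic R n k (f x) 0 0 kn.
  rewrite /beta_quadratic_mean !mul0r !addr0 => {2}<-; congr (_ * _).
  by apply: eq_Rintegral => t _; rewrite !mul0r !addr0.
have ib g := integrable_bernstein_mul R n k g.
have icst := integrable_completed_cst R (f x).
have iB : (cmu R).-integrable `[0, 1]
    (EFin \o (fun t => f t - f x)).
  have := integrableB m01 fi icst.
  by apply: eq_integrable => // t _; rewrite /= -EFinB.
rewrite -{1}c1 -mulrBr -RintegralB//; [|exact: ib..].
have -> : \int[cmu R]_(t in `[0, 1])
    (bernstein n k%:Z t * f t - bernstein n k%:Z t * f x) =
    \int[cmu R]_(t in `[0, 1])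
    (bernstein n k%:Z t * (f t - f x)).
  by apply: eq_Rintegral => t _; rewrite mulrBr.
rewrite normrM ger0_norm// -Rintegral_bernstein_quadratic// -mulrA ler_wpM2l//.
apply: (le_trans (le_normr_Rintegral m01 (ib _ iB))).
have iq := integrable_quadratic R (1 + n%:R * x ^+ 2) (n%:R * (- 2 * x)) n%:R.
rewrite -RintegralZr//; last exact: ib.
apply: le_Rintegral => //.
- exact: (integrable_norm (ib _ iB)).
- have := integrableZr m01 w (ib _ iq).
  by apply: eq_integrable => // t _; rewrite /= -EFinM.
move=> t /= t01.
have p0 : 0 <= bernstein n k%:Z t.
  by apply: bernstein_ge0; move: t01; rewrite in_itv.
rewrite normrM (ger0_norm p0) -mulrA ler_wpM2l//.
have d0 : 0 < (Num.sqrt n%:R)^-1 :> R by rewrite invr_gt0 sqrtr_gt0.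
have := modulus_quadratic R f _ w d0 w0 fw t x t01 x01.
rewrite invrK exprMn sqr_sqrtr// => /le_trans; apply.
by rewrite ler_wpM2r//; lra.
Qed.

(** The weights of the operator sum to 1, so f(x) can be moved inside the sum; the
triangle inequality then reduces the error to the two averages bounded by 2. *)
Lemma durrmeyerM1_error (R : realType) (a0 a1 : nat -> R) (f : R -> R) (n : nat)
  (x w : R) :
  (cmu R).-integrable `[0, 1] (EFin \o f) ->
  2 * a0 n + a1 n = 1 -> (0 < n)%N -> x \in `[0, 1] -> 0 <= w ->
  (omega01 f (Num.sqrt n%:R)^-1 <= w%:E)%E ->
  `|durrmeyerM1 a0 a1 n f x - f x| <=
  (`|acoef a0 a1 x n| + `|acoef a0 a1 (1 - x) n|) * 2 * w.
Proof.
move=> fi a01 n0 x01 w0 fw.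
case: n n0 a01 fw => // m _ a01 fw.
have x01' : 0 <= x <= 1 by move: x01; rewrite in_itv.
set a := acoef a0 a1 x m.+1; set b := acoef a0 a1 (1 - x) m.+1.
have ab1 : a + b = 1 by rewrite /a /b /acoef; lra.
have S1 : \sum_(0 <= k < m.+1) bernstein m k%:Z x = 1.
  have := sum_bernstein_quadratic R m x 1 0 0; rewrite !mul0r !addr0 => <-.
  by apply: eq_bigr => k _; rewrite !mul0r !addr0 mulr1.
have SM : \sum_(0 <= k < m.+2) bernsteinM1 a0 a1 m.+1 k%:Z x * f x = f x.
  rewrite (sum_bernstein_shift R m a b x (fun=> f x)) -mulr_suml S1 mul1r.
  by rewrite -mulrDl ab1 mul1r.
pose V := @beta_quadratic_mean R m.+1 (1 + m.+1%:R * x ^+ 2) (m.+1%:R * (- 2 * x)) m.+1%:R.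
rewrite /durrmeyerM1 mulr_sumr -SM -sumrB.
apply: (le_trans (ler_norm_sum _ _ _)).
apply: (@le_trans _ _ (\sum_(0 <= k < m.+2)
  (`|a| * bernstein m k%:Z x + `|b| * bernstein m (k%:Z - 1) x) * (V k * w))).
  apply: ler_sum_nat => k /andP[_ km].
  have -> : m.+2%:R * (bernsteinM1 a0 a1 m.+1 k%:Z x *
      \int[cmu R]_(t in `[0, 1])
        (bernstein m.+1 k%:Z t * f t)) - bernsteinM1 a0 a1 m.+1 k%:Z x * f x =
      bernsteinM1 a0 a1 m.+1 k%:Z x * (m.+2%:R *
      (\int[cmu R]_(t in `[0, 1])
        (bernstein m.+1 k%:Z t * f t)) - f x) by ring.
  rewrite normrM; apply: ler_pM => //.
    apply: (le_trans (ler_normD _ _)).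
    rewrite normrM [X in _ + X]normrM.
    by rewrite !(ger0_norm (bernstein_ge0 _ _ _ _ x01')).
  exact: Rintegral_bernstein_error.
under eq_bigr do rewrite mulrA.
rewrite -mulr_suml ler_wpM2r// (sum_bernstein_shift R m `|a| `|b| x V) mulrDl.
by apply: lerD; apply: ler_wpM2l => //;
  [exact: bernstein_beta_mean_le2|exact: bernstein_beta_mean_shift_le2].
Qed.

(** Eliminating a_0 gives a(x) = a_1 (x - 1/2) + 1/2. *)
Lemma norm_acoef_le (R : realType) (a0 a1 : nat -> R) (n : nat) (x : R) :
  2 * a0 n + a1 n = 1 -> 0 <= x <= 1 ->
  `|acoef a0 a1 x n| <= (`|a1 n| + 1) / 2.
Proof.
move=> a01 x01.
have -> : acoef a0 a1 x n = a1 n * (x - 1 / 2) + 1 / 2 by rewrite /acoef; lra.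
apply: (le_trans (ler_normD _ _)); rewrite normrM.
have h : `|x - 1 / 2| <= 1 / 2 by rewrite ler_norml; lra.
have -> : `|1 / 2 : R| = 1 / 2 by rewrite ger0_norm.
by have := ler_wpM2l (normr_ge0 (a1 n)) h; lra.
Qed.

Theorem theorem2p6 (R : realType) (a0 a1 : nat -> R) (f : R -> R)
  (fbnd : [bounded f x | x in `[0, 1]])
  (fint : (@completed_lebesgue_measure R).-integrable `[0, 1] (EFin \o f))
  (a1bnd : bounded_fun a1)
  (a01 : forall n : nat, 2 * a0 n + a1 n = 1)
  (n : nat) (hn : (1 <= n)%N) :
  (unorm01 (fun x => (durrmeyerM1 a0 a1 n f x - f x)%R) <=
   ((3 * `|a1 n| + 1) * (1 + Num.sqrt 2))%:E *
     omega01 f (Num.sqrt n%:R)^-1)%E.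
Proof.
have s1 : 1 <= Num.sqrt 2 :> R.
  by rewrite -[leLHS]sqrtr1 ler_sqrt// ler1n.
have A0 := normr_ge0 (a1 n).
have w0 : (0 <= omega01 f (Num.sqrt n%:R)^-1)%E.
  by apply: omega01_ge0; rewrite invr_ge0 sqrtr_ge0.
case E : (omega01 f (Num.sqrt n%:R)^-1) w0 => [w||] // w0.
- have fw : (omega01 f (Num.sqrt n%:R)^-1 <= w%:E)%E by rewrite E.
  rewrite lee_fin in w0.
  apply: ub_ereal_sup => _ [x x01 <-]; rewrite -EFinM lee_fin.
  have x01' : 0 <= x <= 1 by move: x01; rewrite /= in_itv.
  have x01'' : 0 <= 1 - x <= 1 by lra.
  apply: (le_trans (durrmeyerM1_error R a0 a1 f n x w fint (a01 n) hn x01 w0 fw)).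
  rewrite ler_wpM2r//.
  have := norm_acoef_le R a0 a1 n x (a01 n) x01'.
  have := norm_acoef_le R a0 a1 n (1 - x) (a01 n) x01''.
  nra.
- by rewrite gt0_muley ?leey// lte_fin mulr_gt0//; lra.
Qed.
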